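(* Let $P^n$ be an $n$-dimensional polytope. Then $$F(l_\alpha(P^n))=f(P^n)^*.$$
   Context: A combinatorial polytope is a combinatorial equivalence class of convex polytopes; $\mathcal{P}$ is the ring of polytopes: the free abelian group on (non-empty) combinatorial polytopes with multiplication the direct product and unit the point. A finite poset with minimal element $\hat0$ and maximal element $\hat1$ is graded if it has a rank function $\rho$ with $\rho(\hat0)=0$ and $\rho(y)=\rho(x)+1$ whenever $y$ covers $x$; write $\rho(x,y)=\rho(y)-\rho(x)$. $\mathcal{R}$ is the Rota–Hopf algebra (over $\mathbb{Z}$): the free module on isomorphism classes of finite graded posets with multiplication the cartesian product and unit the one-element poset. The linear map $l_\alpha:\mathcal{P}\to\mathcal{R}[\alpha]$ (a ring homomorphism) is $l_\alpha(P)=\sum_{F\subseteq P}\alpha^{\dim F}[F,P]$, the sum over all non-empty faces $F$ of $P$ (including $P$), where $[F,P]$ is the interval in the face lattice of $P$. For a composition $\omega=(j_1,\dots,j_k)$, $j_i\ge1$, $M_\omega=\sum_{l_1<\dots<l_k}t_{l_1}^{j_1}\cdots t_{l_k}^{j_k}$; $\mathrm{Qsym}[t_1,t_2,\dots]$ is the ring of finite integer combinations of the $M_\omega$ (and constants). The Ehrenborg quasi-symmetric function of a graded poset is $F(P)=\sum_{\hat0=x_0<x_1<\dots<x_{k+1}=\hat1}M_{(\rho(x_0,x_1),\rho(x_1,x_2),\dots,\rho(x_k,x_{k+1}))}$ (sum over all chains from $\hat0$ to $\hat1$; $F=1$ on the one-element poset); it is extended linearly, with $F(\alpha)=\alpha$,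 to a ring homomorphism $F:\mathcal{R}[\alpha]\to\mathrm{Qsym}[t_1,t_2,\dots][\alpha]$. The involution $*$ on $\mathrm{Qsym}[t_1,t_2,\dots][\alpha]$ is $\mathbb{Z}[\alpha]$-linear with $M_{(j_1,\dots,j_k)}^*=M_{(j_k,\dots,j_1)}$. The generalized $f$-polynomial is $$f(P^n)=\alpha^n+\sum_{k=1}^{n}\ \sum_{0\leqslant a_1<\dots<a_k\leqslant n-1}f_{a_1,\dots,a_k}\,\alpha^{a_1}M_{(n-a_k,\,a_k-a_{k-1},\dots,\,a_2-a_1)},$$ where $f_{a_1,\dots,a_k}$ is the number of chains of faces $F^{a_1}\subset\dots\subset F^{a_k}$ of $P^n$ with $\dim F^{a_i}=a_i$. *)

(* Defs.v *)
From HB Require Import structures.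
From mathcomp Require Import all_boot all_order all_algebra finmap.
From mathcomp Require Import mathcomp_extra boolp classical_sets functions.
From mathcomp Require Import cardinality reals monalg.

Set Implicit Arguments.
Unset Strict Implicit.
Unset Printing Implicit Defensive.

Import Order.TTheory GRing.Theory Num.Theory.

Local Open Scope ring_scope.

Section FinitePosets.
Variables (T : finType) (le : rel T).
Implicit Types x y z : T.

Definition plt x y := (x != y) && le x y.

Definition covers x y := plt x y && ~~ [exists z, plt x z && plt z y].

Record graded_poset (bot top : T) (rk : T -> nat) : Prop := GradedPoset {
  graded_refl : reflexive le;
  graded_anti : antisymmetric le;
  graded_trans : transitive le;
  graded_bot : forall x, le bot x;
  graded_top : forall x, le x top;
  graded_rk0 : rk bot = 0%N;
  graded_rkS : forall x y, covers x y -> rk y = (rk x).+1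
}.

End FinitePosets.

Definition poset_iso (T T' : Type) (le : rel T) (le' : rel T') : Prop :=
  exists2 f : T -> T', bijective f & {mono f : x y / le x y >-> le' x y}.

Definition prod_rel (T T' : Type) (le : rel T) (le' : rel T') : rel (T * T') :=
  fun u v => le u.1 v.1 && le' u.2 v.2.

(* Carriers are taken among the 'I_n, so that the finite graded posets form a *)
(* small type that still has a member in every isomorphism class.             *)
Record gposet := GPoset {
  gp_card : nat;
  gp_le : rel 'I_gp_card;
  gp_bot : 'I_gp_card;
  gp_top : 'I_gp_card;
  gp_rk : 'I_gp_card -> nat;
  gp_graded : graded_poset gp_le gp_bot gp_top gp_rk
}.

HB.instance Definition _ := gen_eqMixin gposet.
HB.instance Definition _ := gen_choiceMixin gposet.

Lemma poset_iso_refl T (le : rel T) : poset_iso le le.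
Proof. by exists id => //; exists id. Qed.

Lemma poset_iso_sym T T' (le : rel T) (le' : rel T') :
  poset_iso le le' -> poset_iso le' le.
Proof.
by case=> f [g fK gK] fm; exists g; [exists f|move=> x y; rewrite -fm !gK].
Qed.

Lemma poset_iso_trans T1 T2 T3 (le1 : rel T1) (le2 : rel T2) (le3 : rel T3) :
  poset_iso le1 le2 -> poset_iso le2 le3 -> poset_iso le1 le3.
Proof.
case=> f fb fm [g gb gm]; exists (g \o f); first exact: bij_comp.
by move=> x y /=; rewrite gm fm.
Qed.

Lemma poset_iso_prod T1 T2 T3 T4
    (l1 : rel T1) (l2 : rel T2) (l3 : rel T3) (l4 : rel T4) :
  poset_iso l1 l2 -> poset_iso l3 l4 ->
  poset_iso (prod_rel l1 l3) (prod_rel l2 l4).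
Proof.
case=> f [f' fK f'K] fm [g [g' gK g'K] gm].
exists (fun u => (f u.1, g u.2)); last by move=> u v; rewrite /prod_rel /= fm gm.
by exists (fun u => (f' u.1, g' u.2)) => -[a b] /=; rewrite ?fK ?gK ?f'K ?g'K.
Qed.

Definition gp_iso (p q : gposet) : bool := `[< poset_iso (@gp_le p) (@gp_le q) >].

Lemma gp_iso_refl : reflexive gp_iso.
Proof. by move=> p; apply/asboolP; exact: poset_iso_refl. Qed.

Lemma gp_iso_sym : symmetric gp_iso.
Proof.
by move=> p q; apply/asboolP/asboolP => h; exact: poset_iso_sym.
Qed.

Lemma gp_iso_trans : transitive gp_iso.
Proof.
by move=> q p r /asboolP h /asboolP k; apply/asboolP; exact: poset_iso_trans k.
Qed.

Canonical gp_iso_equiv := EquivRel gp_iso gp_iso_refl gp_iso_sym gp_iso_trans.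

Definition gposet_class : Type := {eq_quot gp_iso}%qT.
HB.instance Definition _ := Choice.on gposet_class.
HB.instance Definition _ := EqQuotient.on gposet_class.

Section Transport.
Variables (T : finType) (le : rel T) (bot top : T) (rk : T -> nat).
Hypothesis gT : graded_poset le bot top rk.

Let ole : rel 'I_#|T| := fun i j => le (enum_val i) (enum_val j).

Lemma graded_ord : graded_poset ole (enum_rank bot) (enum_rank top)
                                    (rk \o enum_val).
Proof.
have ltE i j : plt ole i j = plt le (enum_val i) (enum_val j).
  by rewrite /plt (inj_eq enum_val_inj).
case: gT => r a t b tp k0 kS; split.
- by move=> i; apply: r.
- by move=> i j h; apply: enum_val_inj; apply: a.
- by move=> i j k; apply: t.
- by move=> i; rewrite /ole enum_rankK.
- by move=> i; rewrite /ole enum_rankK.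
- by rewrite /= enum_rankK.
move=> i j /andP[]; rewrite ltE => h /existsPn hn /=; apply: kS.
rewrite /covers h /=; apply/existsPn => z.
by have := hn (enum_rank z); rewrite !ltE enum_rankK.
Qed.

Definition gposet_of := GPoset graded_ord.

Lemma gposet_ofP : poset_iso (@gp_le gposet_of) le.
Proof.
exists enum_val; first by exists enum_rank; [exact: enum_valK|exact: enum_rankK].
by [].
Qed.

End Transport.

Lemma graded_unit : graded_poset (fun _ _ : unit => true) tt tt (fun=> 0%N).
Proof. by split=> // -[] [] //; rewrite /covers /plt eqxx. Qed.

Lemma graded_prod (T T' : finType) (le : rel T) (le' : rel T') b t rk b' t' rk' :
  graded_poset le b t rk -> graded_poset le' b' t' rk' ->
  graded_poset (prod_rel le le') (b, b') (t, t')
               (fun u => (rk u.1 + rk' u.2)%N).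
Proof.
move=> [r a tr hb ht k0 kS] [r' a' tr' hb' ht' k0' kS']; split.
- by move=> u; rewrite /prod_rel r r'.
- move=> [u1 u2] [v1 v2] /andP[/andP[/= h1 h2] /andP[/= h3 h4]].
  by congr pair; [apply: a; rewrite h1|apply: a'; rewrite h2].
- move=> v u w /andP[h1 h2] /andP[h3 h4].
  by rewrite /prod_rel (tr _ _ _ h1 h3) (tr' _ _ _ h2 h4).
- by move=> u; rewrite /prod_rel hb hb'.
- by move=> u; rewrite /prod_rel ht ht'.
- by rewrite /= k0 k0'.
move=> [u1 u2] [v1 v2] /andP[]; rewrite {1}/plt /prod_rel /= xpair_eqE negb_and.
move=> /andP[ne /andP[h1 h2]] /existsPn hn.
have [e1|n1] := eqVneq u1 v1.
  have n2 : u2 != v2 by move: ne; rewrite e1 eqxx.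
  rewrite e1 addnC [in RHS]addnC -addSn; congr addn; apply: kS'.
  rewrite /covers /plt n2 h2 /=; apply/existsPn => z.
  have := hn (u1, z); rewrite /plt /prod_rel /= !xpair_eqE e1 eqxx r /=.
  by rewrite /= ?r.
have [e2|n2] := eqVneq u2 v2.
  rewrite e2 -addSn; congr addn; apply: kS.
  rewrite /covers /plt n1 h1 /=; apply/existsPn => z.
  have := hn (z, u2); rewrite /plt /prod_rel /= !xpair_eqE e2 eqxx r' /=.
  by rewrite ?andbT.
have := hn (v1, u2); rewrite /plt /prod_rel /= !xpair_eqE !eqxx r r' h1 h2.
by rewrite ?andbT /= (negbTE n1) (negbTE n2).
Qed.

Definition gposet1 : gposet := gposet_of graded_unit.
Definition gposetM (p q : gposet) : gposet :=
  gposet_of (graded_prod (gp_graded p) (gp_graded q)).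

Definition gclass (p : gposet) : gposet_class := \pi_gposet_class%qT p.

Lemma gclassP p q :
  reflect (poset_iso (@gp_le p) (@gp_le q)) (gclass p == gclass q).
Proof. by rewrite /gclass eqmodE; apply: asboolP. Qed.

Definition gclass1 : gposet_class := gclass gposet1.
Definition gclassM (x y : gposet_class) : gposet_class :=
  gclass (gposetM (repr x) (repr y)).

Lemma reprK_gclass x : gclass (repr x) = x.
Proof. exact: reprK. Qed.

Lemma repr_gclass p : poset_iso (@gp_le (repr (gclass p))) (@gp_le p).
Proof. by apply/gclassP; rewrite reprK_gclass. Qed.

Lemma gclassME p q : gclassM (gclass p) (gclass q) = gclass (gposetM p q).
Proof.
apply/eqP/gclassP; apply: poset_iso_trans (gposet_ofP _) _.
apply: poset_iso_trans (poset_iso_sym (gposet_ofP _)).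
by apply: poset_iso_prod; apply: repr_gclass.
Qed.

Lemma gclassMA : associative gclassM.
Proof.
move=> x y z; rewrite -(reprK_gclass x) -(reprK_gclass y) -(reprK_gclass z).
rewrite !gclassME; apply/eqP/gclassP.
set p := repr x; set q := repr y; set r := repr z.
apply: poset_iso_trans (gposet_ofP _) _.
apply: poset_iso_trans (poset_iso_sym (gposet_ofP _)).
apply: poset_iso_trans
  (poset_iso_prod (poset_iso_refl _) (gposet_ofP _)) _.
apply: poset_iso_trans
  (poset_iso_prod (poset_iso_sym (gposet_ofP _)) (poset_iso_refl _)).
exists (fun u => ((u.1, u.2.1), u.2.2)).
  by exists (fun u => (u.1.1, (u.1.2, u.2))) => [[? []]|[[]]].
by move=> [? [? ?]] [? [? ?]]; rewrite /prod_rel /= andbA.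
Qed.

Lemma gclassMC : commutative gclassM.
Proof.
move=> x y; rewrite -(reprK_gclass x) -(reprK_gclass y) !gclassME.
apply/eqP/gclassP; apply: poset_iso_trans (gposet_ofP _) _.
apply: poset_iso_trans (poset_iso_sym (gposet_ofP _)).
exists (fun u => (u.2, u.1)); first by exists (fun u => (u.2, u.1)) => -[].
by move=> [? ?] [? ?]; rewrite /prod_rel /= andbC.
Qed.

Lemma gclass1M : left_id gclass1 gclassM.
Proof.
move=> x; rewrite -(reprK_gclass x) gclassME; apply/eqP/gclassP.
apply: poset_iso_trans (gposet_ofP _) _.
apply: poset_iso_trans
  (poset_iso_prod (gposet_ofP _) (poset_iso_refl _)) _.
by exists (fun u => u.2) => //; exists (fun v => (tt, v)) => [[[]]|].
Qed.

Lemma gclassM1 : right_id gclass1 gclassM.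
Proof. by move=> x; rewrite gclassMC gclass1M. Qed.

Lemma gclassM_unit x y : gclassM x y = gclass1 -> x = gclass1 /\ y = gclass1.
Proof.
suff H x' y' : gclassM x' y' = gclass1 -> y' = gclass1.
  by move=> h; split; [apply: (H y); rewrite gclassMC|apply: (H x)].
rewrite -(reprK_gclass x') -(reprK_gclass y') gclassME => /eqP/gclassP h.
apply/eqP/gclassP; move: (repr x') (repr y') h => p q h.
apply: poset_iso_trans (poset_iso_sym (gposet_ofP _)).
have {h} [f /bij_inj f_inj _] :=
  poset_iso_trans (poset_iso_sym (gposet_ofP _))
   (poset_iso_trans h (gposet_ofP _)).
have u1 i : i = gp_bot q.
  suff: (gp_bot p, i) = (gp_bot p, gp_bot q) by case.
  by apply: f_inj; case: (f _); case: (f _).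
exists (fun=> tt).
  by exists (fun=> gp_bot q) => [i|[]] //; rewrite [i]u1.
by move=> i j; rewrite (u1 i) (u1 j) (graded_refl (gp_graded q)).
Qed.

HB.instance Definition _ := Choice_isMonomialDef.Build gposet_class
  gclassMA gclass1M gclassM1 gclassM_unit.
HB.instance Definition _ := MonomialDef_isConomialDef.Build gposet_class gclassMC.

Definition rota : Type := {malg int[gposet_class]}.
HB.instance Definition _ := GRing.ComNzRing.on rota.

(* The basis element of rota given by the poset (T, le), and 0 if that poset  *)
(* is not graded.                                                             *)
Definition rota_class (T : finType) (le : rel T) : rota :=
  if pselect (exists p : gposet, poset_iso (@gp_le p) le) is left h
  then << gclass (projT1 (cid h)) >> else 0.

(* Formal power series in t_0, t_1, ... with integer coefficients.            *)
Definition series : Type := {cmonom nat} -> int.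
HB.instance Definition _ := GRing.Zmodule.copy series ({cmonom nat} -> int).

Definition factorizations (m : {cmonom nat}) :=
  fset_set [set p : {cmonom nat} * {cmonom nat} | mmul p.1 p.2 = m]%classic.

Definition seriesM (f g : series) : series :=
  fun m => \sum_(p <- factorizations m) f p.1 * g p.2.

Definition series1 : series := fun m => (m == mone)%:R.

Section SeriesRing.
Implicit Types (m d e : {cmonom nat}) (f g h : series).
Implicit Types p q : {malg int[{cmonom nat}]}.

Lemma mdeg_coef m i : (m i <= mdeg m)%N.
Proof.
rewrite mdegE; case: (mdomP m i) => // ki.
by rewrite (big_fsetD1 i) //= leq_addr.
Qed.

Lemma finite_divisors m :
  finite_set [set d | exists e, mmul d e = m]%classic.
Proof.
pose F (h : {ffun finsupp m -> 'I_(mdeg m).+1}) : {cmonom nat} :=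
  mkcmonom [fsfun i : finsupp m => nat_of_ord (h i) | 0%N].
apply: (@sub_finite_set _ _ (F @` setT)%classic); last first.
  exact/finite_image/finite_finset.
move=> d [e dem]; exists [ffun i => inord (d (val i))] => //.
have dm i : (d i <= m i)%N by rewrite -dem cmM leq_addr.
apply/eqP/cmP => i; rewrite /F cmE fsfun_ffun; case: insubP => [u _ <-|] /=.
  by rewrite ffunE inordK // ltnS (leq_trans (dm _)) ?mdeg_coef.
by rewrite -cmE_eq0 => /eqP mi; move: (dm i); rewrite mi leqn0 => /eqP.
Qed.

Lemma in_factorizations m x : (x \in factorizations m) = (mmul x.1 x.2 == m).
Proof.
have fin : finite_set
    [set p : {cmonom nat} * {cmonom nat} | mmul p.1 p.2 = m]%classic.
  apply: (sub_finite_set _ (finite_setX (finite_divisors m) (finite_divisors m))).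
  move=> [d e] /= dem; split; first by exists e.
  by exists d; rewrite mulmC.
rewrite /factorizations in_fset_set //.
by apply/idP/eqP; [move/set_mem|move=> h; apply/mem_set].
Qed.

Definition agree f p m := forall d e, mmul d e = m -> p@_d = f d.

Lemma agree_div f p m d e : mmul d e = m -> agree f p m -> agree f p d.
Proof.
by move=> dem fp d' e' de; apply: (fp _ (mmul e' e)); rewrite mulmA de.
Qed.

Lemma agree_exists f m : exists p, agree f p m.
Proof.
set D := [fset x.1 | x in factorizations m]%fset.
exists (\sum_(d <- D) << f d *g d >>) => d e dem.
have dD : d \in D.
  by apply/imfsetP; exists (d, e) => //=; rewrite in_factorizations /= dem.
rewrite (big_morph (mcoeff d) (mcoeffD d) (mcoeff0 d)).
transitivity (\sum_(c <- D) f c *+ (c == d)).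
  by apply: eq_bigr => c _; exact: mcoeffU.
rewrite (big_fsetD1 d dD) eqxx big_seq big1 /= ?addr0 // => c.
by rewrite !inE => /andP[/negbTE-> _].
Qed.

Lemma seriesME f g p q m :
  agree f p m -> agree g q m -> seriesM f g m = (p * q)@_m.
Proof.
move=> fp gq; set Fm := factorizations m.
pose d1 := (msupp p `|` [fset x.1 | x in Fm])%fset.
pose d2 := (msupp q `|` [fset x.2 | x in Fm])%fset.
rewrite (@mcoeffMlw _ _ d1 d2) ?fsubsetUl //.
transitivity (\sum_(x <- [seq (i, j) | i <- d1, j <- d2])
                p@_x.1 * q@_x.2 *+ (mmul x.1 x.2 == m)); last first.
  by rewrite big_allpairs_dep.
under [RHS]eq_bigr do rewrite mulrb.
rewrite -big_mkcond -big_filter.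
have /(perm_big _)-> :
    perm_eq [seq x <- [seq (i, j) | i <- d1, j <- d2] | mmul x.1 x.2 == m] Fm.
  apply: uniq_perm; last 1 first; rewrite ?fset_uniq //.
  - move=> x; rewrite mem_filter in_factorizations andb_idr // => xm.
    have xF : x \in Fm by rewrite in_factorizations.
    by case: x xm xF => a b _ xF; apply: allpairs_f; rewrite inE;
      apply/orP; right; apply/imfsetP; exists (a, b).
  rewrite filter_uniq //; apply: allpairs_uniq; rewrite ?fset_uniq //.
  by move=> [? ?] [? ?] _ _.
rewrite /seriesM !big_seq; apply: eq_bigr => -[a b].
rewrite in_factorizations => /eqP /= abm; rewrite (fp _ _ abm).
by rewrite (gq b a) // mulmC.
Qed.

Lemma agreeM f g p q m :
  agree f p m -> agree g q m -> agree (seriesM f g) (p * q) m.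
Proof.
move=> fp gq d e dem; apply/esym/seriesME; exact: agree_div dem _.
Qed.

Lemma agree1 m : agree series1 1 m.
Proof. by move=> d e _; rewrite mcoeff1. Qed.

Lemma seriesMA : associative seriesM.
Proof.
move=> f g h; apply/funext => m.
have [[p fp] [q gq]] := (agree_exists f m, agree_exists g m).
have [r hr] := agree_exists h m.
rewrite (seriesME fp (agreeM gq hr)) (seriesME (agreeM fp gq) hr).
by rewrite mulrA.
Qed.

Lemma seriesMC : commutative seriesM.
Proof.
move=> f g; apply/funext => m.
have [[p fp] [q gq]] := (agree_exists f m, agree_exists g m).
by rewrite (seriesME fp gq) (seriesME gq fp) mulrC.
Qed.

Lemma series1M : left_id series1 seriesM.
Proof.
move=> f; apply/funext => m; have [p fp] := agree_exists f m.
by rewrite (seriesME (@agree1 m) fp) mul1r (fp m mone) ?mulm1.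
Qed.

Lemma seriesMDl : left_distributive seriesM +%R.
Proof.
move=> f g h; apply/funext => m.
rewrite [RHS]/GRing.add /= /seriesM -big_split /=.
by apply: eq_bigr => x _; rewrite -mulrDl.
Qed.

Lemma series1_neq0 : series1 != 0.
Proof.
by apply/eqP => /(congr1 (fun f : series => f mone)); rewrite /series1 eqxx.
Qed.

End SeriesRing.

HB.instance Definition _ := GRing.Zmodule_isComNzRing.Build series
  seriesMA seriesMC series1M seriesMDl series1_neq0.

Lemma series_oneE m : (1 : series) m = (m == mone)%:R.
Proof. by []. Qed.

Lemma series_mulE (f g : series) m :
  (f * g) m = \sum_(p <- factorizations m) f p.1 * g p.2.
Proof. by []. Qed.

Lemma series_subE (f g : series) m : (f - g) m = f m - g m.
Proof. by []. Qed.

(* The exponents of m, read by increasing index of the variables.             *)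
Definition mexps (m : {cmonom nat}) : seq nat :=
  [seq m i | i <- sort leq (finsupp m)].

(* The monomial t_{l_1}^{j_1} ... t_{l_k}^{j_k} with l_1 < ... < l_k and all  *)
(* j_i > 0 determines the l_i and the j_i, hence occurs in exactly one M_w,   *)
(* with coefficient 1; see qmon_seriesE. A sequence w with a null entry is    *)
(* not a composition and gets the value 0.                                    *)
Definition qmon_series (w : seq nat) : series := fun m => (mexps m == w)%:R.

Definition is_qsym (f : series) : Prop :=
  exists r : seq (int * seq nat), f = \sum_(p <- r) qmon_series p.2 *~ p.1.

Definition tmon (w : seq nat) : {cmonom nat} :=
  \big[mmul/mone]_(i < size w) expcmn (ucm (i : nat)) (nth 0%N w i).

Section QuasiSymmetric.
Implicit Types (m d e : {cmonom nat}) (f g h : series).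

Lemma sorted_supp m : sorted ltn (sort leq (finsupp m)).
Proof.
by rewrite ltn_sorted_uniq_leq sort_uniq fset_uniq sort_sorted //; exact: leq_total.
Qed.

Lemma sort_suppE m l : sorted ltn l -> l =i finsupp m ->
  sort leq (finsupp m) = l.
Proof.
move=> sl lm; apply: (irr_sorted_eq ltn_trans ltnn (sorted_supp m) sl).
by move=> i; rewrite mem_sort lm.
Qed.

Lemma expcmnE (i : nat) n j : expcmn (ucm i) n j = (n * (i == j))%N.
Proof.
rewrite /expcmn; case: n => [|n]; first by rewrite [LHS]onecmE.
rewrite iteropS; elim: n => [|n IHn]; first by rewrite [LHS]ucmE mul1n.
by rewrite [LHS]mulcmE IHn ucmE mulSn.
Qed.

Lemma big_mmulE (I : Type) (r : seq I) (F : I -> {cmonom nat}) j :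
  (\big[mmul/mone]_(i <- r) F i) j = (\sum_(i <- r) F i j)%N.
Proof.
by elim/big_rec2: _ => [|i y1 y2 _ <-]; rewrite ?cm1 ?cmM.
Qed.

Lemma tmonE w j : tmon w j = nth 0%N w j.
Proof.
rewrite /tmon big_mmulE; under eq_bigr do rewrite expcmnE.
have [jw|jw] := ltnP j (size w); last first.
  rewrite nth_default // big1 // => i _; rewrite (_ : _ == j = false) ?muln0 //.
  by apply/eqP => ij; move: (ltn_ord i); rewrite ij ltnNge jw.
rewrite (bigD1 (Ordinal jw)) //= eqxx muln1 big1 ?addn0 // => i.
by rewrite -val_eqE /= => /negbTE->; rewrite muln0.
Qed.

Lemma mexps_tmon w : all (leq 1) w -> mexps (tmon w) = w.
Proof.
move=> wp; rewrite /mexps (@sort_suppE _ (iota 0 (size w))) ?iota_ltn_sorted //.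
  by under eq_map do rewrite tmonE; exact: mkseq_nth.
move=> i; rewrite mem_iota add0n -cmE_neq0 tmonE -lt0n.
have [iw|iw] := ltnP i (size w); last by rewrite nth_default.
by apply/esym/(allP wp)/mem_nth.
Qed.

Lemma mexps_pos m : all (leq 1) (mexps m).
Proof.
by apply/allP => _ /mapP[i + ->]; rewrite mem_sort -cmE_neq0 lt0n.
Qed.

Lemma sumn_mexps m : sumn (mexps m) = mdeg m.
Proof.
rewrite sumnE /mexps big_map mdegE; apply: perm_big; exact/permPl/perm_sort.
Qed.

Lemma mdeg_tmon w : mdeg (tmon w) = sumn w.
Proof.
rewrite /tmon mdeg_prod sumnE (big_nth 0%N) big_mkord; apply: eq_bigr => i _.
rewrite mdegE; have [->|wi] := eqVneq (nth 0 w i) 0%N.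
  by rewrite big1 // => j _; rewrite expcmnE.
rewrite (_ : finsupp _ = [fset (i : nat)]%fset) ?big_seq_fset1 ?expcmnE ?eqxx ?muln1 //.
apply/fsetP => j; rewrite -cmE_neq0 expcmnE muln_eq0 negb_or wi inE.
by rewrite eqb0 negbK eq_sym.
Qed.

Lemma mexps_mul_supp m d e : mmul d e = m ->
  mexps d = [seq x <- [seq d i | i <- sort leq (finsupp m)] | x != 0%N].
Proof.
move=> dem; rewrite filter_map; congr map; apply: sort_suppE.
  exact: (sorted_filter ltn_trans) (sorted_supp m).
move=> i; rewrite mem_filter mem_sort /= cmE_neq0 andb_idr //.
by rewrite -!cmE_neq0 -dem cmM addn_eq0 negb_and => ->.
Qed.

Definition exps_invariant f := forall m m', mexps m = mexps m' -> f m = f m'.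
Definition exps_bounded f := exists N, forall m, (N < mdeg m)%N -> f m = 0.

Lemma exps_invariantE f m : exps_invariant f -> f m = f (tmon (mexps m)).
Proof. by move=> fi; apply: fi; rewrite mexps_tmon ?mexps_pos. Qed.

Lemma exps_bounded_seq N : exists r : seq (seq nat),
  forall m, (mdeg m <= N)%N -> mexps m \in r.
Proof.
exists (flatten [seq [seq map val (tval t) | t <- enum {: k.-tuple 'I_N.+1}]
                    | k <- iota 0 N.+1]) => m mN.
have sN : (size (mexps m) < N.+1)%N.
  rewrite ltnS (leq_trans _ mN) // -sumn_mexps.
  elim: (mexps m) (mexps_pos m) => //= x s IHs /andP[x0 /IHs h].
  by rewrite -add1n leq_add.
apply/flatten_mapP; exists (size (mexps m)); first by rewrite mem_iota.
apply/mapP; exists (map_tuple inord (in_tuple (mexps m))); first by rewrite mem_enum.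
rewrite /= -map_comp map_id_in // => x xm /=; rewrite inordK // ltnS.
rewrite (leq_trans _ mN) //; case/mapP: xm => i _ ->; exact: mdeg_coef.
Qed.

Lemma seriesE_sum (I : Type) (r : seq I) (F : I -> series) m :
  (\sum_(i <- r) F i) m = \sum_(i <- r) F i m.
Proof. by elim/big_rec2: _ => // i y1 y2 _ <-. Qed.

Lemma seriesE_mulz f (z : int) m : (f *~ z) m = f m *~ z.
Proof.
have n_mul n : (f *+ n) m = f m *+ n.
  by elim: n => // n IHn; rewrite !mulrS [LHS]/GRing.add /= IHn.
by case: z => n; rewrite ?NegzE ?mulrNz -!pmulrn ?n_mul // [LHS]/GRing.opp /= n_mul.
Qed.

Lemma is_qsymP f : is_qsym f <-> exps_invariant f /\ exps_bounded f.
Proof.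
split=> [[r ->]|[fi [N fN]]].
  split=> [m m' mm'|].
    rewrite !seriesE_sum; apply: eq_bigr => p _.
    by rewrite !seriesE_mulz /qmon_series mm'.
  exists (\sum_(p <- r) sumn p.2)%N => m mN; rewrite seriesE_sum.
  rewrite big_seq big1 // => p pr; rewrite seriesE_mulz /qmon_series.
  rewrite (_ : _ == _ = false) ?mul0rz //; apply/eqP => mp.
  move: mN; rewrite -sumn_mexps mp ltnNge (big_rem p) //= leq_addr //.
have [r rP] := exps_bounded_seq N.
exists [seq (f (tmon w), w) | w <- undup r]; apply/funext => m.
rewrite seriesE_sum big_map.
under eq_bigr do rewrite seriesE_mulz.
have [mr|mr] := boolP (mexps m \in r).
  rewrite (bigD1_seq (mexps m)) ?undup_uniq ?mem_undup //=.
  rewrite /qmon_series eqxx -exps_invariantE // intz big1 ?addr0 // => w wm.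
  by rewrite eq_sym (negbTE wm) mul0rz.
rewrite big_seq big1 => [|w]; last first.
  rewrite mem_undup => wr; rewrite /qmon_series (_ : _ == _ = false) ?mul0rz //.
  by apply: contraNF mr => /eqP->.
by apply: fN; rewrite ltnNge; apply: contra mr; apply: rP.
Qed.

Lemma exps_invariantM f g :
  exps_invariant f -> exps_invariant g -> exps_invariant (f * g).
Proof.
move=> fi gi; pose A m d := [seq d i | i <- sort leq (finsupp m)] : seq nat.
pose B m := [seq (A m x.1, A m x.2) | x <- factorizations m].
pose nz s := [seq x <- s | x != 0%N] : seq nat.
pose G (x : seq nat * seq nat) := f (tmon (nz x.1)) * g (tmon (nz x.2)).
have fgE m : (f * g) m = \sum_(x <- B m) G x.
  rewrite big_map series_mulE !big_seq; apply: eq_bigr => -[d e].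
  rewrite in_factorizations => /eqP /= dem; rewrite /G /nz /=.
  have edm : mmul e d = m by rewrite -dem mulmC.
  rewrite {1}(exps_invariantE d fi) {1}(exps_invariantE e gi).
  by rewrite (mexps_mul_supp dem) (mexps_mul_supp edm).
have A_inj m d e d' e' : mmul d e = m -> mmul d' e' = m ->
    A m d = A m d' -> d = d'.
  move=> dem dem' /eq_in_map dd'; apply/eqP/cmP => i.
  have [im|] := boolP (i \in finsupp m); first by apply: dd'; rewrite mem_sort.
  rewrite -cmE_eq0 => /eqP mi; move: (mi) (mi); rewrite -{1}dem -{1}dem' !cmM.
  by move=> /eqP; rewrite addn_eq0 => /andP[/eqP-> _] /eqP;
     rewrite addn_eq0 => /andP[/eqP-> _].
have B_uniq m : uniq (B m).
  rewrite map_inj_in_uniq ?fset_uniq // => -[d e] [d' e'].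
  rewrite !in_factorizations /= => /eqP dem /eqP dem' [dd' ee'].
  congr pair; first exact: A_inj dem dem' dd'.
  by apply: (@A_inj m e d e' d') ee'; rewrite mulmC.
have memB m x : (x \in B m) = [&& size x.1 == size (mexps m),
     size x.2 == size (mexps m) &
     [seq (y.1 + y.2)%N | y <- zip x.1 x.2] == mexps m].
  apply/mapP/and3P => [[[d e]]|].
    rewrite in_factorizations => /eqP /= dem ->; rewrite /A !size_map; split=> //=.
    rewrite zip_map -map_comp; apply/eqP/eq_map => i /=.
    by rewrite -dem cmM.
  case: x => u v /= [/eqP su /eqP sv /eqP uv].
  set s := sort leq (finsupp m); have ss : size s = size (mexps m) by rewrite size_map.
  have s_uniq : uniq s by rewrite sort_uniq fset_uniq.
  pose D w : {cmonom nat} :=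
    mkcmonom [fsfun i in finsupp m => nth 0%N w (index i s) | 0%N].
  have DE w i : D w i = if i \in finsupp m then nth 0%N w (index i s) else 0%N.
    by rewrite /D cmE fsfun_fun.
  have AD w : size w = size s -> A m (D w) = w.
    move=> sw; apply: (@eq_from_nth _ 0%N); first by rewrite size_map.
    rewrite size_map => i si; rewrite (nth_map 0%N) // DE -(mem_sort leq) mem_nth //.
    by rewrite index_uniq.
  exists (D u, D v); last by rewrite /= !AD ?ss.
  rewrite in_factorizations /=; apply/cmP => i; rewrite cmM !DE.
  have [im|im] := boolP (i \in finsupp m); last first.
    by move: im; rewrite -cmE_eq0 => /eqP->.
  have il : (index i s < size s)%N by rewrite index_mem mem_sort.
  have := congr1 (fun t => nth 0%N t (index i s)) uv.
  rewrite (nth_map (0%N, 0%N)) ?size_zip ?su ?sv ?minnn -?ss //.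
  rewrite nth_zip ?su ?sv //= => ->.
  by rewrite (nth_map 0%N) // nth_index // mem_sort.
move=> m m' mm'; rewrite !fgE; apply: perm_big; apply: uniq_perm => // x.
by rewrite !memB mm'.
Qed.

Lemma exps_boundedM f g : exps_bounded f -> exps_bounded g -> exps_bounded (f * g).
Proof.
move=> [N fN] [K gK]; exists (N + K)%N => m mN.
rewrite series_mulE big_seq big1 // => -[d e].
rewrite in_factorizations => /eqP /= dem.
have [dN|dN] := ltnP N (mdeg d); first by rewrite fN // mul0r.
rewrite [g e]gK ?mulr0 // ltnNge; apply: contraL mN => eK.
by rewrite -leqNgt -dem mdegM leq_add.
Qed.

Definition qsym_pred : {pred series} := fun f => `[< is_qsym f >].

Lemma qsym_subring : subring_closed qsym_pred.
Proof.
split.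
- apply/asboolP/is_qsymP; split=> [m m' mm'|].
    rewrite !series_oneE -!mdeg_eq0 -!sumn_mexps mm' //.
  by exists 0%N => m; rewrite lt0n series_oneE mdeg_eq0 => /negbTE->.
- move=> f g /asboolP/is_qsymP[fi [N fN]] /asboolP/is_qsymP[gi [K gK]].
  apply/asboolP/is_qsymP; split=> [m m' mm'|].
    by rewrite !series_subE (fi _ _ mm') (gi _ _ mm').
  exists (maxn N K) => m; rewrite gtn_max => /andP[mN mK].
  by rewrite series_subE fN // gK // subr0.
move=> f g /asboolP/is_qsymP[fi fb] /asboolP/is_qsymP[gi gb].
apply/asboolP/is_qsymP; split; [exact: exps_invariantM|exact: exps_boundedM].
Qed.

End QuasiSymmetric.

HB.instance Definition _ :=
  GRing.isSubringClosed.Build series qsym_pred qsym_subring.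

Record qsym := Qsym { qsym_series :> series; _ : qsym_series \in qsym_pred }.

HB.instance Definition _ := [isSub for qsym_series].
HB.instance Definition _ := [Choice of qsym by <:].
HB.instance Definition _ := [SubChoice_isSubComNzRing of qsym by <:].

Lemma qmon_subproof w : qmon_series w \in qsym_pred.
Proof. by apply/asboolP; exists [:: (1, w)]; rewrite big_seq1. Qed.

Definition qmon (w : seq nat) : qsym := Qsym (qmon_subproof w).

Lemma qmon_seriesE w m : all (leq 1) w ->
  qmon_series w m = `[< exists l, [/\ sorted ltn l, size l = size w &
      m = \big[mmul/mone]_(p <- zip l w) expcmn (ucm p.1) p.2] >]%:R.
Proof.
move=> wp; congr (nat_of_bool _)%:R; apply/eqP/asboolP.
  move=> <-; exists (sort leq (finsupp m)).
  split; [exact: sorted_supp|by rewrite size_map|].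
  rewrite /mexps -{1}(map_id (sort leq (finsupp m))) zip_map big_map.
  apply/eqP/cmP => j; rewrite big_mmulE.
  under eq_bigr do rewrite expcmnE.
  rewrite (perm_big (finsupp m)) /=; last exact/permPl/perm_sort.
  case: (mdomP m j) => [jm|jm].
    rewrite (big_fsetD1 j) //= eqxx muln1 big_seq big1 ?addn0 // => i.
    by rewrite !inE => /andP[/negbTE-> _]; rewrite muln0.
  rewrite big_seq big1 // => i im; rewrite (_ : _ == _ = false) ?muln0 //.
  by apply: contraNF jm => /eqP<-.
case=> l [sl szl ->]; set m' := \big[_/_]_(_ <- _) _.
have l_uniq : uniq l := sorted_uniq ltn_trans ltnn sl.
have m'E k : (k < size l)%N -> m' (nth 0%N l k) = nth 0%N w k.
  move=> kl; rewrite /m' big_mmulE (big_nth (0%N, 0%N)) size_zip szl minnn.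
  rewrite big_mkord; move: (kl); rewrite szl => kw.
  rewrite (bigD1 (Ordinal kw)) //= expcmnE nth_zip //= eqxx muln1 big1 ?addn0 //.
  move=> i; rewrite -val_eqE /= => ik; rewrite expcmnE nth_zip //=.
  by rewrite nth_uniq ?szl // (negbTE ik) muln0.
rewrite /mexps (@sort_suppE _ l) //.
  apply: (@eq_from_nth _ 0%N); first by rewrite size_map.
  by rewrite size_map => k kl; rewrite (nth_map 0%N) // m'E.
move=> j; rewrite -cmE_neq0; apply/idP/idP.
  move=> jl; rewrite -(nth_index 0%N jl) m'E ?index_mem // -lt0n.
  by apply/(allP wp)/mem_nth; rewrite -szl index_mem.
apply: contraR => jl; rewrite /m' big_mmulE big_seq big1 // => -[a b] ab.
rewrite expcmnE /= (_ : _ == _ = false) ?muln0 //.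
apply: contraNF jl => /eqP<-; move: ab => /(map_f fst).
by rewrite -/unzip1 unzip1_zip ?szl.
Qed.

Definition star_series (f : series) : series :=
  fun m => f (tmon (rev (mexps m))).

Lemma star_subproof (q : qsym) : star_series q \in qsym_pred.
Proof.
case: q => f /= /asboolP/is_qsymP[fi [N fN]]; apply/asboolP/is_qsymP; split.
  by move=> m m' mm'; rewrite /star_series mm'.
by exists N => m mN; apply: fN; rewrite mdeg_tmon sumn_rev sumn_mexps.
Qed.

(* The coefficient of qsym_star q along M_w is the coefficient of q along     *)
(* M_(rev w), which is that of the monomial tmon (rev w).                     *)
Definition qsym_star (q : qsym) : qsym := Qsym (star_subproof q).

Lemma qsym_star_zmod_morphism : zmod_morphism qsym_star.
Proof. by move=> p q; apply/val_inj/funext => m. Qed.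

HB.instance Definition _ :=
  GRing.isZmodMorphism.Build qsym qsym qsym_star qsym_star_zmod_morphism.

Lemma qsym_star_qmon w : qsym_star (qmon w) = qmon (rev w).
Proof.
apply/val_inj/funext => m.
rewrite /= /star_series /qmon_series mexps_tmon ?all_rev ?mexps_pos //.
by rewrite (can2_eq revK revK).
Qed.

(* Sum over the chains gp_bot p = x_0 < x_1 < ... < x_k = gp_top p, where s    *)
(* lists x_1, ..., x_k; a chain in p has at most gp_card p elements. For the  *)
(* one-element poset only k = 0 contributes, with qmon [::] = 1.              *)
Definition ehrenborg_gposet (p : gposet) : qsym :=
  \sum_(k < gp_card p)
    \sum_(s : k.-tuple 'I_(gp_card p) |
            path (plt (@gp_le p)) (gp_bot p) s && (last (gp_bot p) s == gp_top p))
      qmon (pairmap (fun x y => gp_rk y - gp_rk x)%N (gp_bot p) s).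

(* Isomorphic graded posets have the same ehrenborg_gposet, so the choice of  *)
(* the representative is immaterial.                                          *)
Definition ehrenborg (r : rota) : qsym :=
  \sum_(c <- msupp r) ehrenborg_gposet (repr c) *~ r@_c.

Definition ehrenborg_poly : {poly rota} -> {poly qsym} := map_poly ehrenborg.

Definition qsym_star_poly : {poly qsym} -> {poly qsym} := map_poly qsym_star.

Section Polytopes.
Local Open Scope classical_set_scope.
Variables (R : realType) (d : nat).
Implicit Types (P A : set 'rV[R]_d) (V : seq 'rV[R]_d).

Definition convex_hull V : set 'rV[R]_d :=
  [set x | exists a : 'I_(size V) -> R,
     [/\ forall i, 0 <= a i, \sum_i a i = 1 & x = \sum_i a i *: V`_i]].

Definition polytope P := exists2 V, V != [::] & P = convex_hull V.

(* Supporting hyperplanes; c = 0 yields the faces P and set0.                 *)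
Definition is_face P (F : set 'rV[R]_d) :=
  exists (c : 'cV[R]_d) (b : R),
    (forall x, P x -> (x *m c) 0 0 <= b) /\
    F = [set x | P x /\ (x *m c) 0 0 = b].

(* The affine dimension: the largest k such that A contains k + 1 affinely    *)
(* independent points x0, x0 + row 0 X, ..., x0 + row (k - 1) X.              *)
Definition adim A : nat :=
  \max_(k < d.+1 | `[< exists (x0 : 'rV[R]_d) (X : 'M[R]_(k, d)),
     [/\ A x0, forall i, A (x0 + row i X) & row_free X] >]) k.

(* A polytope has finitely many faces, so fset_set loses nothing.             *)
Definition faces P : {fset set 'rV[R]_d} :=
  fset_set [set F | is_face P F /\ F !=set0].

Definition face_le P : rel (faces P) := fun F G => `[< val F `<=` val G >].

(* The interval [F, P] of the face lattice.                                   *)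
Definition face_interval P (F : faces P) : finType :=
  {G : faces P | face_le F G}.

Definition interval_le P (F : faces P) : rel (face_interval F) :=
  fun G H => face_le (val G) (val H).

Definition l_alpha P : {poly rota} :=
  \sum_(F : faces P) rota_class (@interval_le P F) *: 'X^(adim (val F)).

Definition flag_number P (a : seq nat) : nat :=
  #|[pred c : (size a).-tuple (faces P) |
      sorted (plt (@face_le P)) c && ([seq adim (val G) | G <- c] == a)]|.

(* For a = (a_1, ..., a_k) the pairmap below is                               *)
(* (n - a_k, a_k - a_(k-1), ..., a_2 - a_1).                                  *)
Definition f_polynomial n P : {poly qsym} :=
  'X^n +
  \sum_(1 <= k < n.+1)
    \sum_(a : k.-tuple 'I_n | sorted ltn [seq val i | i <- a])
      let s := [seq val i | i <- a] in
      (qmon (pairmap subn n (rev s)) *+ flag_number P s) *: 'X^(head 0%N s).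

End Polytopes.

(* Main.v *)
Require Import Defs.
From HB Require Import structures.
From mathcomp Require Import all_boot all_order all_algebra finmap.
From mathcomp Require Import mathcomp_extra boolp classical_sets functions.
From mathcomp Require Import cardinality reals monalg lra.

Set Implicit Arguments.
Unset Strict Implicit.
Unset Printing Implicit Defensive.

Import Order.TTheory GRing.Theory Num.Theory.

Local Open Scope ring_scope.

(* The coefficient of 'X^i on either side is a sum over the chains            *)
(* F_0 < ... < F_k = P of faces with adim F_0 = i, the chain contributing     *)
(* M_w for the composition w of its successive dimension jumps: on the left   *)
(* these are the chains from bottom to top of the intervals [F_0, P]; on the  *)
(* right they are the flags counted by f_(a_1, ..., a_k), completed by P,     *)
(* with * undoing the reversal in the definition of f. This needs [F, P] to   *)
(* be graded by adim G - adim F, that is, adim to jump by exactly one at each *)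
(* covering pair of faces, which is shown by rotating a supporting hyperplane *)
(* of the smaller face about it until it meets another vertex of the larger.  *)

(** Expanding the Ehrenborg function over every interval [F_0, P] makes the coefficient of ['X^i] on
    the left a sum over chains F_0 < ... < F_k = P with [adim] F_0 = i ([coef_ehrenborg_l_alpha]).
    Splitting each flag number into its individual flags, to which P is appended, gives the same sum
    on the right, where ['X^n] is the chain consisting of P alone ([flag_sum],
    [coef_star_f_polynomial]).

    The weights agree only if ranks in [F_0, P] are differences of dimension. The order determines
    the rank function ([graded_unique]), so it suffices that dimension grows by one along coverings
    ([adim_face_cover]): two nested faces whose dimensions differ by at least two have a third one
    strictly between them ([intermediate_face]). As a class in [rota] remembers its poset only up to
    isomorphism, [ehrenborg_face_interval] carries the chains of an arbitrary representative into
    the face lattice. *)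

Section AffineDimension.
Local Open Scope classical_set_scope.
Variables (R : realType) (d : nat).
Implicit Types (A : set 'rV[R]_d) (x y : 'rV[R]_d).

Lemma adim_ge A k x0 (X : 'M[R]_(k, d)) :
  A x0 -> (forall i, A (x0 + row i X)) -> row_free X -> (k <= adim A)%N.
Proof.
move=> Ax0 AX Xf; have kd : (k < d.+1)%N.
  by move: (Xf); rewrite /row_free => /eqP {1}<-; rewrite ltnS rank_leq_col.
rewrite /adim; apply: (@leq_bigmax_cond _ _ (fun i : 'I_d.+1 => i : nat) (Ordinal kd)).
by apply/asboolP; exists x0, X.
Qed.

Lemma adim_attained A : A !=set0 -> exists x0 (X : 'M[R]_(adim A, d)),
  [/\ A x0, forall i, A (x0 + row i X) & row_free X].
Proof.
case=> y Ay; rewrite /adim.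
pose Q (k : 'I_d.+1) := `[< exists x0 (X : 'M[R]_(k, d)),
  [/\ A x0, forall i, A (x0 + row i X) & row_free X] >].
have [|k /asboolP Qk ->] := @eq_bigmax_cond _ Q (fun i : 'I_d.+1 => i : nat) => //.
apply/card_gt0P; exists ord0; apply/asboolP; exists y, 0; split => //; first by case.
by rewrite /row_free -leqn0 rank_leq_row.
Qed.

Lemma extend_frame A k x0 (X : 'M[R]_(k, d)) y :
  (forall i, A (x0 + row i X)) -> row_free X -> A y ->
  ~~ (y - x0 <= X)%MS ->
  (forall i, A (x0 + row i (col_mx X (y - x0)))) /\ row_free (col_mx X (y - x0)).
Proof.
move=> AX Xf Ay yX; split.
  move=> i; case: (splitP i) => j ij.
    by rewrite (_ : i = lshift 1 j) ?rowKu //; apply: val_inj.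
  rewrite (_ : i = rshift k j); last exact: val_inj.
  by rewrite rowKd [j]ord1 (_ : row 0 _ = y - x0) ?subrKC //; apply/rowP => l; rewrite !mxE.
have [lr er] := mxrank_leqif_sup (addsmxSl X (y - x0)).
rewrite /row_free eqn_leq rank_leq_row /= -addsmxE addn1.
move: Xf => /eqP Xf; rewrite -{1}Xf ltn_neqAle lr er andbT.
by rewrite addsmx_sub submx_refl.
Qed.

Lemma adim_span A x0 (X : 'M[R]_(adim A, d)) y :
  A x0 -> (forall i, A (x0 + row i X)) -> row_free X -> A y ->
  (y - x0 <= X)%MS.
Proof.
move=> Ax0 AX Xf Ay; apply/negPn/negP => yX.
have [A' X'f] := extend_frame AX Xf Ay yX.
by have := adim_ge Ax0 A' X'f; rewrite addn1 ltnn.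
Qed.

Lemma adim_le_span A k x0 (X : 'M[R]_(k, d)) :
  A !=set0 -> (forall y, A y -> (y - x0 <= X)%MS) -> (adim A <= k)%N.
Proof.
move=> /adim_attained[y0 [Y [Ay0 AY /eqP Yf]]] h.
rewrite -Yf (leq_trans _ (rank_leq_row X)) //; apply: mxrankS.
apply/row_subP => i; rewrite (_ : row i Y = (y0 + row i Y - x0) - (y0 - x0)).
  by rewrite addmx_sub ?eqmx_opp ?h.
by rewrite opprB addrA subrK addrAC subrr add0r.
Qed.

(** The slack of [x] in the inequality x c <= b. It is affine in [x], and faces are the zero sets of
    slacks that are nonnegative on the polytope. *)
Definition gap (c : 'cV[R]_d) (b : R) x : R := b - (x *m c) 0 0.

Lemma gap_diff c b x y : gap c b x - gap c b y = ((y - x) *m c) 0 0.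
Proof. by rewrite /gap mulmxBl !mxE; lra. Qed.

(** The linear part of the gap kills every direction of a maximal frame of [A] but not [y - x0], so
    [y] extends that frame inside [B]. *)
Lemma adim_lt_gap A B c b y : A !=set0 -> A `<=` B ->
  (forall x, A x -> gap c b x = 0) -> B y -> gap c b y != 0 -> (adim A < adim B)%N.
Proof.
move=> A0 AB Ac By gy; have [x0 [X [Ax0 AX Xf]]] := adim_attained A0.
have yX : ~~ (y - x0 <= X)%MS.
  apply: contra gy => /submxP[D yD]; have Xc : X *m c = 0.
    apply/row_matrixP => i; rewrite row_mul row0; apply/rowP => j; rewrite [j]ord1.
    have := gap_diff c b x0 (x0 + row i X).
    by rewrite !Ac // subrr addrAC subrr add0r !mxE => <-.
  have := gap_diff c b x0 y; rewrite Ac // sub0r yD -mulmxA Xc mulmx0 mxE.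
  by move/eqP; rewrite oppr_eq0.
have [BX X'f] := extend_frame (fun i => AB _ (AX i)) Xf By yX.
by have := adim_ge (AB _ Ax0) BX X'f; rewrite addn1.
Qed.

End AffineDimension.

(** * Faces of a convex hull, and their dimensions along coverings *)

Section Faces.
Local Open Scope classical_set_scope.
Variables (R : realType) (d : nat) (V : seq 'rV[R]_d).
Local Notation P := (convex_hull V).
Implicit Types (F G H : set 'rV[R]_d) (x y : 'rV[R]_d).

Lemma vertex_in_hull (i : 'I_(size V)) : P V`_i.
Proof.
exists (fun j => (j == i)%:R); split.
- by move=> j; rewrite ler0n.
- by rewrite (bigD1 i) //= eqxx big1 ?addr0 // => j /negbTE->.
rewrite (bigD1 i) //= eqxx scale1r big1 ?addr0 // => j /negbTE->.
by rewrite scale0r.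
Qed.

Lemma gap_comb c b (a : 'I_(size V) -> R) : \sum_i a i = 1 ->
  gap c b (\sum_i a i *: V`_i) = \sum_i a i * gap c b V`_i.
Proof.
move=> a1; rewrite /gap mulmx_suml summxE -{1}(mul1r b) -a1 mulr_suml -sumrB.
by apply: eq_bigr => i _; rewrite -scalemxAl mxE mulrBr.
Qed.

Lemma gap_hull_ge0 c b : (forall i : 'I_(size V), 0 <= gap c b V`_i) ->
  forall x, P x -> 0 <= gap c b x.
Proof.
move=> h _ [a [a0 a1 ->]]; rewrite gap_comb //.
by apply: sumr_ge0 => i _; rewrite mulr_ge0.
Qed.

(** A vanishing sum of nonnegative terms has only zero terms: a point of a face is a combination of
    generators lying in that face. *)
Lemma gap_comb_eq0 c b (a : 'I_(size V) -> R) :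
  (forall i, 0 <= a i) -> \sum_i a i = 1 ->
  (forall i : 'I_(size V), 0 <= gap c b V`_i) ->
  gap c b (\sum_i a i *: V`_i) = 0 -> forall i, a i != 0 -> gap c b V`_i = 0.
Proof.
move=> a0 a1 h; rewrite gap_comb // => /eqP; rewrite psumr_eq0; last first.
  by move=> i _; rewrite mulr_ge0.
move=> /allP s0 i ai; apply/eqP; have := s0 i (mem_index_enum i).
by rewrite /= mulf_eq0 (negbTE ai).
Qed.

Lemma is_faceP F : is_face P F <-> exists c b,
  (forall x, P x -> 0 <= gap c b x) /\ F = [set x | P x /\ gap c b x = 0].
Proof.
have ge0 c b x : (0 <= gap c b x) = ((x *m c) 0 0 <= b) by rewrite /gap subr_ge0.
have eq0 c b x : (gap c b x = 0) <-> ((x *m c) 0 0 = b).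
  by rewrite /gap; split=> [/eqP|->]; rewrite ?subrr // subr_eq0 => /eqP.
split=> -[c [b [h ->]]]; exists c, b; split=> [x /h|]; rewrite ?ge0 //;
by apply/seteqP; split=> x /= [Px /eq0].
Qed.

Lemma face_sub_vertices F G : is_face P F -> is_face P G ->
  (forall i : 'I_(size V), F V`_i -> G V`_i) -> F `<=` G.
Proof.
move=> /is_faceP[c [b [cb ->]]] /is_faceP[c' [b' [cb' ->]]] h _ [[a [a0 a1 ->]] e].
split; first by exists a.
rewrite gap_comb // big1 // => i _; have [->|ai] := eqVneq (a i) 0; first by rewrite mul0r.
have vi i' := cb _ (vertex_in_hull i').
have [|_ ->] := h i; last by rewrite mulr0.
by split; [exact: vertex_in_hull|exact: gap_comb_eq0 e _ ai].
Qed.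

Lemma finite_faces : finite_set [set F | is_face P F /\ F !=set0].
Proof.
(* A face is determined by the generators it contains; [h S] is the union of the faces whose set of
   generators is [S], which avoids choosing one. *)
pose h (S : {set 'I_(size V)}) : set 'rV[R]_d := [set x | exists F,
  [/\ is_face P F, forall i : 'I_(size V), i \in S <-> F V`_i & F x]].
apply: (@sub_finite_set _ _ (h @` setT)); last exact/finite_image/finite_finset.
move=> F [Ff _]; exists [set i : 'I_(size V) | `[< F V`_i >]]%SET => //.
apply/seteqP; split=> x /=.
  case=> G [Gf GF]; apply: face_sub_vertices => // i /GF.
  by rewrite inE => /asboolP.
move=> Fx; exists F; split => // i; rewrite inE.
by split => [/asboolP|?]; last exact/asboolP.
Qed.

Lemma adim_face_lt F G : is_face P F -> is_face P G -> F !=set0 ->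
  F `<=` G -> F != G -> (adim F < adim G)%N.
Proof.
move=> /is_faceP[c [b [cb Fe]]] /is_faceP[c' [b' [cb' Ge]]] F0 FG nFG.
have [y Gy nFy] : exists2 y, G y & ~ F y.
  apply: contrapT => h; move/eqP: nFG; apply; apply/seteqP; split => // y Gy.
  by apply: contrapT => nFy; apply: h; exists y.
apply: (@adim_lt_gap _ _ F G c b y) => //; first by rewrite Fe => x [].
apply/eqP => gy; apply: nFy; rewrite Fe; split => //.
by move: Gy; rewrite Ge => -[].
Qed.

(* An affine function psi that vanishes on F, and is not proportional on G to  *)
(* a support function phi of F, yields psi - t * phi, which supports G in a   *)
(* strictly larger proper face for the largest admissible t; adding a large   *)
(* multiple of a support function of G makes this a face of P.                *)
Lemma intermediate_face F G : is_face P F -> is_face P G -> F !=set0 ->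
  F `<=` G -> ((adim F).+1 < adim G)%N ->
  exists H, [/\ is_face P H, F `<=` H, H `<=` G, F != H & H != G].
Proof.
move=> /is_faceP[c1 [b1 [cb1 Fe]]] /is_faceP[c2 [b2 [cb2 Ge]]] F0 FG dFG.
have [x0 [X [Fx0 FX Xf]]] := adim_attained F0.
have G0 : G !=set0 by exists x0; exact: FG.
have [g1 Gg1 g1X] : exists2 g, G g & ~~ (g - x0 <= X)%MS.
  apply: contrapT => h; move: dFG; rewrite ltnNge => /negP; apply.
  apply: leqW; apply: (@adim_le_span _ _ _ _ x0 X G0) => y Gy.
  by apply/negPn/negP => yX; apply: h; exists y.
have [GX' X'f] := extend_frame (fun i => FG _ (FX i)) Xf Gg1 g1X.
set X' := col_mx X (g1 - x0) in GX' X'f.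
have [g2 Gg2 g2X] : exists2 g, G g & ~~ (g - x0 <= X')%MS.
  apply: contrapT => h; move: dFG; rewrite ltnNge -addn1 => /negP; apply.
  apply: (@adim_le_span _ _ _ _ x0 X' G0) => y Gy.
  by apply/negPn/negP => yX; apply: h; exists y.
(* A column of the cokernel matrix: a linear form that vanishes on the directions of F and on
   [g1 - x0], but not on [g2 - x0]. *)
have [e X'e g2e] : exists2 e : 'cV[R]_d, X' *m e = 0 & ((g2 - x0) *m e) 0 0 != 0.
  move: g2X; rewrite submxE => /rV0Pn[j gj]; exists (col j (cokermx X')).
    by rewrite colE mulmxA mulmx_coker mul0mx.
  have colM (K : 'M[R]_d) : ((g2 - x0) *m col j K) 0 0 = ((g2 - x0) *m K) 0 j.
    by rewrite colE mulmxA -colE mxE.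
  by rewrite colM.
have [Xe g1e] : X *m e = 0 /\ ((g1 - x0) *m e) = 0.
  by move: X'e; rewrite mul_col_mx -[RHS]vsubmxK => /eq_col_mx[-> ->]; rewrite !linear0.
have {}g1X : 0 < gap c1 b1 g1.
  rewrite lt_neqAle cb1 ?andbT; last by move: Gg1; rewrite Ge => -[].
  apply: contraNN g1X => /eqP g10; apply: (@adim_span _ _ F) => //.
  by rewrite Fe; split => //; move: Gg1; rewrite Ge => -[].
pose psi := gap (- e) (- (x0 *m e) 0 0).
have psiE x : psi x = ((x - x0) *m e) 0 0.
  by rewrite /psi /gap mulmxN mulmxBl !mxE opprK addrC.
have psiF x : F x -> psi x = 0.
  move=> Fx; rewrite psiE; have /submxP[D ->] := adim_span Fx0 FX Xf Fx.
  by rewrite -mulmxA Xe mulmx0 mxE.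
pose phi := gap c1 b1; pose phi2 := gap c2 b2.
pose v (i : 'I_(size V)) := V`_i.
have v1 i : 0 <= phi (v i) := cb1 _ (vertex_in_hull i).
have v2 i : 0 <= phi2 (v i) := cb2 _ (vertex_in_hull i).
(* The generators in G but not in F; one exists because [phi] is positive at [g1]. *)
pose Q i := (phi2 (v i) == 0) && (phi (v i) != 0).
have [i0 Qi0] : exists i, Q i.
  move: Gg1 g1X; rewrite Ge => -[[a [a0 a1 ->]]] g10; rewrite gap_comb // => sp.
  have [i /andP[_ ai]] : exists i, true && (0 < a i * phi (v i)).
    apply/existsP; apply: contraTT sp => /existsPn h; rewrite -leNgt.
    by apply: sumr_le0 => i _; rewrite leNgt; exact: h.
  have ai0 : a i != 0 by apply: contraTneq ai => ->; rewrite mul0r ltxx.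
  exists i; rewrite /Q; apply/andP; split.
    by apply/eqP; exact: gap_comb_eq0 g10 _ ai0.
  by apply: contraTneq ai => ->; rewrite mulr0 ltxx.
pose i1 := [arg min_(i < i0 | Q i) (psi (v i) / phi (v i))]%O.
have [Qi1 tmin] : Q i1 /\ forall j, Q j -> psi (v i1) / phi (v i1) <= psi (v j) / phi (v j).
  by rewrite /i1; case: arg_minP.
(* The minimal ratio is the largest t for which psi - t phi is nonnegative on G; equality at [v i1]
   puts a generator outside F into the new face. *)
set t := psi (v i1) / phi (v i1) in tmin.
(* Each summand alone makes the combined gap positive at its own generator outside G; all summands
   are nonnegative, so the sum serves every such generator. *)
pose N := \sum_(i | phi2 (v i) != 0) (1 + `|psi (v i) - t * phi (v i)|) / phi2 (v i).
pose c := - e - t *: c1 + N *: c2.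
pose b := - (x0 *m e) 0 0 - t * b1 + N * b2.
have chiE x : gap c b x = psi x - t * phi x + N * phi2 x.
  by rewrite /psi /phi /phi2 /gap /c /b mulmxDr mulmxBr -!scalemxAr !mxE; lra.
have chi_v i : 0 <= gap c b (v i) /\ (phi2 (v i) != 0 -> 0 < gap c b (v i)).
  rewrite chiE; have [z2|nz2] := eqVneq (phi2 (v i)) 0.
    split => //; rewrite z2 mulr0 addr0.
    have [z1|nz1] := eqVneq (phi (v i)) 0.
      rewrite z1 mulr0 subr0 psiF // Fe; split => //; exact: vertex_in_hull.
    have p1 : 0 < phi (v i) by rewrite lt_neqAle eq_sym nz1 v1.
    rewrite subr_ge0 -ler_pdivlMr //; apply: tmin.
    by rewrite /Q z2 eqxx.
  have p2 : 0 < phi2 (v i) by rewrite lt_neqAle eq_sym nz2 v2.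
  suff h : 0 < psi (v i) - t * phi (v i) + N * phi2 (v i) by split => //; exact: ltW.
  have NE : (1 + `|psi (v i) - t * phi (v i)|) / phi2 (v i) <= N.
    rewrite /N (bigD1 i) //= lerDl; apply: sumr_ge0 => j _.
    by rewrite divr_ge0 // addr_ge0.
  move: NE; rewrite ler_pdivrMr //.
  have := ler_norm (- (psi (v i) - t * phi (v i))); rewrite normrN; lra.
have chi_ge0 i : 0 <= gap c b (v i) by case: (chi_v i).
pose H := [set x | P x /\ gap c b x = 0].
have HG : H `<=` G.
  move=> _ [[a [a0 a1 ->]] x0']; rewrite Ge; split; first by exists a.
  rewrite gap_comb // big1 // => i _; have [->|ai] := eqVneq (a i) 0; first by rewrite mul0r.
  have /eqP vi0 := gap_comb_eq0 a0 a1 chi_ge0 x0' ai.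
  suff /eqP h : phi2 (v i) == 0 by rewrite [gap _ _ _]h mulr0.
  apply: contraTT vi0 => /(proj2 (chi_v i)) h.
  by rewrite gt_eqF.
have /andP[/eqP q2 q1] := Qi1.
exists H; split => //.
- by apply/is_faceP; exists c, b; split => //; exact: gap_hull_ge0.
- move=> x Fx; split; first by move: Fx; rewrite Fe => -[].
  have p2 : phi2 x = 0 by move: (FG _ Fx); rewrite Ge => -[].
  have p1 : phi x = 0 by move: Fx; rewrite Fe => -[].
  by rewrite chiE (psiF _ Fx) p1 p2 !mulr0 subrr addr0.
- apply: contraNneq (q1) => FH; suff: F (v i1) by rewrite Fe => -[_ /eqP].
  rewrite FH; split; first exact: vertex_in_hull.
  by rewrite chiE q2 mulr0 addr0 /t (divfK q1) subrr.
apply/eqP => HG'.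
have chiG x : G x -> psi x - t * phi x = 0.
  move=> Gx; have : phi2 x = 0 by move: Gx; rewrite Ge => -[].
  by move: Gx; rewrite -HG' => -[_]; rewrite chiE => + p0; rewrite p0 mulr0 addr0.
(* If H were all of G, then psi = t phi on G. At [g1] psi vanishes and phi does not, which forces t
   = 0; but psi is nonzero at [g2]. *)
have t0 : t = 0.
  have /eqP := chiG _ Gg1; rewrite psiE g1e mxE sub0r oppr_eq0 mulf_eq0.
  by rewrite (gt_eqF g1X) orbF => /eqP.
by move/eqP: (chiG _ Gg2); rewrite t0 mul0r subr0 psiE (negbTE g2e).
Qed.

Lemma adim_face_cover F G : is_face P F -> is_face P G -> F !=set0 ->
  F `<=` G -> F != G ->
  ~ (exists H, [/\ is_face P H, F `<=` H, H `<=` G, F != H & H != G]) ->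
  adim G = (adim F).+1.
Proof.
move=> Ff Gf F0 FG nFG h; apply/eqP; rewrite eqn_leq adim_face_lt // andbT.
by rewrite leqNgt; apply/negP => /(intermediate_face Ff Gf F0 FG).
Qed.

Lemma hull_is_face : is_face P P.
Proof.
exists 0, 0; split=> [x _|]; first by rewrite mulmx0 mxE.
by apply/seteqP; split=> x => [Px|[]] //; split => //; rewrite mulmx0 mxE.
Qed.

End Faces.

(** * Reindexing sums over chains *)

Section ChainSums.
Variable V : nmodType.

Lemma big_tuple_cons (T : finType) k (Q : pred (seq T)) (E : seq T -> V) :
  \sum_(s : k.+1.-tuple T | Q s) E s =
  \sum_(y : T) \sum_(s : k.-tuple T | Q (y :: s)) E (y :: s).
Proof.
rewrite pair_big_dep /=.
rewrite (reindex (fun p : T * k.-tuple T => [tuple of p.1 :: p.2])) //=.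
exists (fun t : k.+1.-tuple T => (thead t, [tuple of behead t])).
  by case=> y s _ /=; congr pair; apply: val_inj.
by move=> t _; rewrite /= -tuple_eta.
Qed.

Lemma big_tuple0 (T : finType) (Q : pred (seq T)) (E : seq T -> V) :
  \sum_(s : 0.-tuple T | Q s) E s = if Q [::] then E [::] else 0.
Proof.
rewrite big_mkcond (big_pred1 [tuple]) //= => t.
by rewrite [t]tuple0 /= eqxx.
Qed.

Lemma path_sum_cons (T : finType) (r : rel T) x k (E : seq T -> V) :
  \sum_(s : k.+1.-tuple T | path r x s) E s =
  \sum_(y | r x y) \sum_(s : k.-tuple T | path r y s) E (y :: s).
Proof.
rewrite (@big_tuple_cons _ _ (path r x)) [RHS]big_mkcond.
apply: eq_bigr => y _ /=; case: (r x y) => //=.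
by rewrite big_pred0.
Qed.

Lemma path_sum_rcons (T : finType) (r : rel T) x t k (E : seq T -> V) :
  \sum_(s : k.+1.-tuple T | path r x s && (last x s == t)) E s =
  \sum_(s : k.-tuple T | path r x s && r (last x s) t) E (rcons s t).
Proof.
elim: k x E => [|k IHk] x E;
  rewrite (@big_tuple_cons _ _ (fun s => path r x s && (last x s == t))) /=.
  rewrite (@big_tuple0 _ (fun s => path r x s && r (last x s) t)
             (fun s => E (rcons s t))) /=.
  transitivity (\sum_(y | y == t) if r x y then E [:: y] else 0).
    rewrite [RHS]big_mkcond; apply: eq_bigr => y _.
    rewrite (@big_tuple0 _ (fun s => r x y && path r y s && (last y s == t))
               (fun s => E (y :: s))) /= andbT.
    by case: (r x y); case: eqP.
  by rewrite big_pred1_eq.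
rewrite (@big_tuple_cons _ _ (fun s => path r x s && r (last x s) t)
           (fun s => E (rcons s t))).
apply: eq_bigr => y _ /=; case: (r x y) => /=; last by rewrite !big_pred0.
exact: (IHk y (fun s => E (y :: s))).
Qed.

(** The image of [f] is closed upwards, so a chain that starts in it never leaves it. This
    identifies chains of [F, P] with chains of the whole face lattice that start at F. *)
Lemma path_sum_transfer (T T' : finType) (r : rel T) (r' : rel T') (f : T -> T')
    (f_inj : injective f) (fr : forall x y, r' (f x) (f y) = r x y)
    (f_up : forall x y', r' (f x) y' -> y' \in codom f) k x (E : seq T' -> V) :
  \sum_(s : k.-tuple T | path r x s) E (map f s) =
  \sum_(s : k.-tuple T' | path r' (f x) s) E s.
Proof.
elim: k x E => [|k IHk] x E.
  by rewrite (@big_tuple0 _ (path r x) (fun s => E (map f s)))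
             (@big_tuple0 _ (path r' (f x)) E).
rewrite (@path_sum_cons _ r x k (fun s => E (map f s))) path_sum_cons.
rewrite [RHS](eq_bigl
    (fun y' => (y' \in [set f y | y in [set: T]]) && r' (f x) y')); last first.
  move=> y'; case e: (r' _ _); rewrite ?andbF // andbT.
  by have /codomP[y ->] := f_up _ _ e; rewrite imset_f.
rewrite big_imset_cond /=; last by move=> y z _ _ /f_inj.
apply: eq_big => [y|y _]; first by rewrite inE fr.
exact: (IHk y (fun s => E (f y :: s))).
Qed.

Lemma big_ord_vanish (G : nat -> V) m n :
  (forall k, (m <= k)%N -> G k = 0) -> (forall k, (n <= k)%N -> G k = 0) ->
  \sum_(k < m) G k = \sum_(k < n) G k.
Proof.
wlog mn : m n / (m <= n)%N => [h|].
  by case/orP: (leq_total m n) => mn Gm Gn; [|apply/esym]; exact: h.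
move=> Gm _; rewrite (big_ord_widen n G mn) big_mkcond.
by apply: eq_bigr => k _; case: ltnP => // /Gm.
Qed.

End ChainSums.

(** * Uniqueness of ranks, and the Ehrenborg function under isomorphism *)

Section GradedPosets.

Lemma plt_trans (T : finType) (le : rel T) :
  antisymmetric le -> transitive le -> transitive (plt le).
Proof.
move=> a t y x z /andP[xy lxy] /andP[yz lyz]; rewrite /plt (t _ _ _ lxy lyz) andbT.
by apply: contraNneq xy => xz; apply/eqP/a; rewrite lxy xz.
Qed.

Lemma plt_irr (T : finType) (le : rel T) : irreflexive (plt le).
Proof. by move=> x; rewrite /plt eqxx. Qed.

Lemma graded_path_size (T : finType) (le : rel T) bot top rk x s :
  graded_poset le bot top rk -> path (plt le) x s -> (size s < #|T|)%N.
Proof.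
case=> _ a t _ _ _ _ /(@sorted_uniq _ _ _ _ (x :: s)) u.
have /card_uniqP e : uniq (x :: s).
  by apply: u; [exact: plt_trans|exact: plt_irr].
rewrite -[(size s).+1]/(size (x :: s)) -e; exact: max_card.
Qed.

Lemma exists_cover (T : finType) (le : rel T) x y :
  antisymmetric le -> transitive le -> plt le x y -> exists z, covers le z y.
Proof.
move=> a t xy.
(* Among the elements below [y], one with the most elements below it is covered by [y]. *)
have [z zy zmax] :=
  @arg_maxnP _ x (fun z => plt le z y) (fun z => #|[pred u | plt le u z]|) xy.
exists z; rewrite /covers zy /=; apply/existsPn => u; apply/negP => /andP[zu uy].
have /= := zmax _ uy; rewrite /geq /= leqNgt => /negP; apply; apply/proper_card/properP.
split; last by exists z; rewrite !inE ?plt_irr.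
by apply/fintype.subsetP => v; rewrite !inE => vz; apply: (plt_trans a t) vz zu.
Qed.

(** Ranks are forced by descending along coverings to the bottom, by induction on the number of
    elements below [x]. *)
Lemma graded_unique (T : finType) (le : rel T) bot top rk bot' top' rk' :
  graded_poset le bot top rk -> graded_poset le bot' top' rk' ->
  [/\ bot = bot', top = top' & rk =1 rk'].
Proof.
move=> [r a t b tp k0 kS] [_ _ _ b' tp' k0' kS'].
have eb : bot = bot' by apply: a; rewrite b b'.
split=> // [|x]; first by apply: a; rewrite tp tp'.
have [m] := ubnP #|[pred u | plt le u x]|; elim: m x => // m IHm x xm.
have [<-|nx] := eqVneq bot x; first by rewrite k0 eb k0'.
have /(exists_cover a t)[z zx] : plt le bot x by rewrite /plt nx b.
rewrite (kS _ _ zx) (kS' _ _ zx); congr S; apply: IHm.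
have /andP[ltzx _] := zx; rewrite ltnS in xm; apply: leq_trans xm; apply/proper_card/properP.
split; last by exists z; rewrite !inE ?plt_irr.
by apply/fintype.subsetP => v; rewrite !inE => vz; apply: (plt_trans a t) vz ltzx.
Qed.

Lemma graded_iso (T T' : finType) (le : rel T) (le' : rel T') f g bot top rk :
  cancel f g -> cancel g f -> {mono f : x y / le x y >-> le' x y} ->
  graded_poset le' bot top rk ->
  graded_poset le (g bot) (g top) (fun x => rk (f x)).
Proof.
move=> fK gK fm [r a t b tp k0 kS].
have ltE x y : plt le' (f x) (f y) = plt le x y.
  by rewrite /plt fm (inj_eq (can_inj fK)).
split.
- by move=> x; rewrite -fm.
- by move=> x y; rewrite -!fm => /a /(can_inj fK).
- by move=> x y z; rewrite -!fm; apply: t.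
- by move=> x; rewrite -fm gK.
- by move=> x; rewrite -fm gK.
- by rewrite gK.
move=> x y /andP[xy /existsPn h]; apply: kS; rewrite /covers ltE xy /=.
by apply/existsPn => z; have := h (g z); rewrite -!ltE gK.
Qed.

Lemma ehrenborg_gposet_transfer (p : gposet) (T : finType) (le : rel T)
    (f : 'I_(gp_card p) -> T) (rk : T -> nat) :
  injective f -> {mono f : x y / gp_le x y >-> le x y} ->
  (forall x y', le (f x) y' -> y' \in codom f) ->
  (forall x y, gp_rk y - gp_rk x = rk (f y) - rk (f x))%N ->
  ehrenborg_gposet p =
  \sum_(k < gp_card p)
    \sum_(s : k.-tuple T | path (plt le) (f (gp_bot p)) s &&
                           (last (f (gp_bot p)) s == f (gp_top p)))
      qmon (pairmap (fun x y => rk y - rk x)%N (f (gp_bot p)) s).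
Proof.
move=> f_inj fm f_up frk; apply: eq_bigr => k _.
rewrite big_mkcondr [RHS]big_mkcondr.
pose E s := if last (f (gp_bot p)) s == f (gp_top p)
  then qmon (pairmap (fun x y => rk y - rk x)%N (f (gp_bot p)) s) else 0.
rewrite -(path_sum_transfer (r := plt (@gp_le p)) f_inj _ _ _ _ E); last 2 first.
- by move=> x y; rewrite /plt fm (inj_eq f_inj).
- by move=> x y' /andP[_ /f_up].
rewrite {}/E; apply: eq_bigr => s _; rewrite last_map (inj_eq f_inj); case: eqP => // _.
congr qmon; move: (gp_bot p); elim: (tval s) => //= y s' IHs x.
by rewrite frk IHs.
Qed.

Lemma ehrenborg_widen (D : {fset gposet_class}) (r : rota) :
  (msupp r `<=` D)%fset ->
  ehrenborg r = \sum_(c <- D) ehrenborg_gposet (repr c) *~ r@_c.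
Proof.
move=> rD; rewrite /ehrenborg; apply: big_fset_incl => // c _ /mcoeff_outdom->.
by rewrite mulr0z.
Qed.

Lemma ehrenborg_zmod_morphism : zmod_morphism ehrenborg.
Proof.
move=> p q; pose D := (msupp p `|` msupp q `|` msupp (p - q))%fset.
rewrite !(@ehrenborg_widen D) ?fsubsetUr //.
- rewrite -sumrB; apply: eq_bigr => c _.
  by rewrite (_ : (p - q)@_c = p@_c - q@_c) ?mulrzBr // mcoeffB.
- by rewrite /D -fsetUA [in X in (_ `<=` X)%fset]fsetUCA fsubsetUl.
- by rewrite /D -fsetUA fsubsetUl.
Qed.

HB.instance Definition _ :=
  GRing.isZmodMorphism.Build rota qsym ehrenborg ehrenborg_zmod_morphism.

Lemma ehrenborg_gclass p : ehrenborg << gclass p >> = ehrenborg_gposet (repr (gclass p)).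
Proof. by rewrite /ehrenborg msuppU1 big_seq_fset1 mcoeffUU. Qed.

(** Both [rota_class] and [ehrenborg] choose representatives, so [p] is known only up to
    isomorphism. *)
Lemma ehrenborg_rota_class (T : finType) (le : rel T) bot top rk :
  graded_poset le bot top rk ->
  exists2 p : gposet, poset_iso (@gp_le p) le &
    ehrenborg (rota_class le) = ehrenborg_gposet p.
Proof.
move=> gT; rewrite /rota_class; case: pselect => [h|[]]; last first.
  by exists (gposet_of gT); exact: gposet_ofP.
case: (cid h) => /= p pT; exists (repr (gclass p)); last exact: ehrenborg_gclass.
exact: poset_iso_trans (repr_gclass p) pT.
Qed.

Lemma qmon_nil : qmon [::] = 1.
Proof.
apply/val_inj/funext => m; rewrite /= /qmon_series [RHS]series_oneE.
by rewrite -mdeg_eq0 -sumn_mexps; case: (mexps m) (mexps_pos m) => //= -[].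
Qed.

(** Here the involution cancels the reversal in [f_polynomial]: the jumps are read upwards again,
    ending at [n]. *)
Lemma rev_pairmap_subn n x (s : seq nat) :
  rev (pairmap subn n (rev (x :: s))) = pairmap (fun a b => b - a)%N x (rcons s n).
Proof.
have pairmap_rcons (f : nat -> nat -> nat) u t y :
    pairmap f u (rcons t y) = rcons (pairmap f u t) (f (last u t) y).
  by elim: t u => //= z t IHt u; rewrite IHt.
elim: s x => [|y s IHs] x //; rewrite rev_cons pairmap_rcons rev_rcons IHs /=.
by rewrite rev_cons last_rcons.
Qed.

End GradedPosets.

(** * The face lattice, its upper intervals and its flags *)

Section FaceLattice.
Local Open Scope classical_set_scope.
Variables (R : realType) (d : nat) (V : seq 'rV[R]_d).
Hypothesis V0 : V != [::].
Local Notation P := (convex_hull V).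
Local Notation lt := (plt (@face_le R d P)).
Implicit Types F G H : faces P.

Lemma in_faces A : (A \in faces P) <-> is_face P A /\ A !=set0.
Proof.
rewrite /faces in_fset_set; last exact: finite_faces.
by split=> [/set_mem h|h]; [exact: h|exact/mem_set].
Qed.

Lemma facesP F : is_face P (val F) /\ val F !=set0.
Proof. exact/in_faces/valP. Qed.

Lemma face_leP F G : reflect (val F `<=` val G) (face_le F G).
Proof. exact: asboolP. Qed.

Lemma face_le_refl : reflexive (@face_le R d P).
Proof. by move=> F; apply/face_leP. Qed.

Lemma face_le_anti : antisymmetric (@face_le R d P).
Proof.
by move=> F G /andP[/face_leP FG /face_leP GF]; apply/val_inj/seteqP.
Qed.

Lemma face_le_trans : transitive (@face_le R d P).
Proof.
by move=> G F H /face_leP FG /face_leP GH; apply/face_leP; exact: subset_trans GH.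
Qed.

Lemma whole_in_faces : P \in faces P.
Proof.
apply/in_faces; split; first exact: hull_is_face.
case: V V0 => // v V' _; exists v; exact: (@vertex_in_hull _ _ (v :: V') ord0).
Qed.

Definition whole_face : faces P := FSetSub whole_in_faces.

Lemma le_whole_face F : face_le F whole_face.
Proof.
apply/face_leP; have [[c [b [_ ->]]] _] := facesP F.
by move=> x [].
Qed.

Lemma adim_lt F G : lt F G -> (adim (val F) < adim (val G))%N.
Proof.
move=> /andP[nFG /face_leP FG]; have [Ff F0] := facesP F.
by have [Gf _] := facesP G; apply: (adim_face_lt Ff Gf F0 FG); rewrite (inj_eq val_inj).
Qed.

Lemma adim_le F G : face_le F G -> (adim (val F) <= adim (val G))%N.
Proof.
have [->|nFG] := eqVneq F G; first by [].
by move=> FG; apply/ltnW/adim_lt; rewrite /plt nFG.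
Qed.

Lemma adim_covers F G : covers (@face_le R d P) F G ->
  adim (val G) = (adim (val F)).+1.
Proof.
move=> /andP[/andP[nFG /face_leP FG] /existsPn h].
have [[Ff F0] [Gf _]] := (facesP F, facesP G).
apply: (adim_face_cover Ff Gf F0 FG) => [|[H [Hf FH HG nFH nHG]]]; first by rewrite (inj_eq val_inj).
have Hin : H \in faces P.
  by apply/in_faces; split => //; case: F0 => x Fx; exists x; exact: FH.
have := h (FSetSub Hin); rewrite /plt -!val_eqE /= nFH nHG /=.
by move/negP; apply; apply/andP; split; apply/face_leP.
Qed.

Lemma lt_whole_face F : lt F whole_face = (adim (val F) < adim P)%N.
Proof.
apply/idP/idP => [/adim_lt //|FP]; rewrite /plt le_whole_face andbT.
by apply: contraTneq FP => ->; rewrite ltnn.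
Qed.

(** Dimensions increase along the chain, so the bound on the last face is the bound on all of them.
    This matches chains that can be completed by P with flags indexed by ['I_(adim P)]. *)
Lemma face_path_all F s :
  path lt F s -> lt (last F s) whole_face = all (fun G => adim (val G) < adim P)%N (F :: s).
Proof.
elim: s F => [|G s IHs] F /=; first by rewrite lt_whole_face andbT.
move=> /andP[FG /IHs ->] /=; case h: (_ < _)%N => /=; last by rewrite andbF.
by rewrite (ltn_trans (adim_lt FG) h).
Qed.

Lemma face_path_adim F s :
  path lt F s -> (adim (val F) + size s <= adim (val (last F s)))%N.
Proof.
elim: s F => [|G s IHs] F /=; first by rewrite addn0.
by move=> /andP[/adim_lt FG /IHs]; apply: leq_trans; rewrite addnS -addSn leq_add2r.
Qed.

Lemma face_interval_graded F :
  graded_poset (@interval_le R d P F)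
    (exist _ F (face_le_refl F)) (exist _ whole_face (le_whole_face F))
    (fun G : face_interval F => adim (val (sval G)) - adim (val F))%N.
Proof.
split.
- by move=> G; exact: face_le_refl.
- by move=> G H GH; apply/val_inj/face_le_anti.
- by move=> G H K; exact: face_le_trans.
- by move=> G; exact: (valP G).
- by move=> G; exact: le_whole_face.
- by rewrite subnn.
move=> G H /andP[GH /existsPn h].
rewrite (@adim_covers (sval G) (sval H)) ?subSn ?adim_le ?(valP G) //.
(* A covering in the interval is one in the face lattice, since any face in between also contains
   F. *)
have ltE (K L : face_interval F) : plt (@interval_le R d P F) K L = lt (sval K) (sval L).
  by rewrite /plt -(inj_eq val_inj).
rewrite /covers -ltE GH /=; apply/existsPn => K; apply/negP => /andP[GK KH].
have FK : face_le F K by apply: face_le_trans (valP G) _; case/andP: GK.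
by have := h (exist _ K FK); rewrite !ltE /= GK KH.
Qed.

Definition chain_weight F (s : seq (faces P)) : qsym :=
  qmon (pairmap (fun G H => adim (val H) - adim (val G))%N F s).

Lemma ehrenborg_face_interval F :
  ehrenborg (rota_class (@interval_le R d P F)) =
  \sum_(k < (adim P).+1) \sum_(s : k.-tuple (faces P) |
      path lt F s && (last F s == whole_face)) chain_weight F s.
Proof.
have gF := face_interval_graded F.
have [p [f [g fK gK] fm] ->] := ehrenborg_rota_class gF.
have [eb et erk] := graded_unique (gp_graded p) (graded_iso fK gK fm gF).
pose f' x := sval (f x).
have fb : f' (gp_bot p) = F by rewrite /f' eb gK.
have ft : f' (gp_top p) = whole_face by rewrite /f' et gK.
have f'_inj : injective f' by move=> x y /val_inj /(can_inj fK).
have f'm : {mono f' : x y / gp_le x y >-> face_le x y} by move=> x y; exact: fm.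
have f'_up x G : face_le (f' x) G -> G \in codom f'.
  move=> xG; have FG : face_le F G := face_le_trans (valP (f x)) xG.
  by apply/codomP; exists (g (exist _ G FG)); rewrite /f' gK.
have f'rk x y : (gp_rk y - gp_rk x = adim (val (f' y)) - adim (val (f' x)))%N.
  by rewrite !erk subnBA ?subnK ?adim_le ?(valP (f _)).
rewrite (@ehrenborg_gposet_transfer p _ (@face_le R d P) f' (fun G => adim (val G))) //.
rewrite fb ft.
(* The two cut-offs on chain length, by the cardinal of [p] and by dimension, differ; beyond either
   one there are no chains. *)
apply: (@big_ord_vanish _ (fun k => \sum_(s : k.-tuple (faces P) |
   path lt F s && (last F s == whole_face)) chain_weight F s)) => k hk.
  rewrite big_mkcondr -fb.
  rewrite -(path_sum_transfer (r := plt (@gp_le p)) f'_inj _ _ _ _ (fun s =>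
     if last (f' (gp_bot p)) s == whole_face then chain_weight (f' (gp_bot p)) s else 0));
    last 2 first.
  - by move=> x y; rewrite /plt f'm (inj_eq f'_inj).
  - by move=> x y' /andP[_ /f'_up].
  rewrite big_pred0 // => s; apply: contraTF hk.
  by move/(graded_path_size (gp_graded p)); rewrite size_tuple card_ord ltnNge.
rewrite big_pred0 // => s; apply: contraTF hk => /andP[/face_path_adim + /eqP e].
by rewrite e size_tuple -ltnNge ltnS; apply: leq_trans; rewrite leq_addl.
Qed.

Lemma flag_numberE k (a : seq nat) : size a = k ->
  flag_number P a = #|[pred c : k.-tuple (faces P) |
      sorted lt c && ([seq adim (val G) | G <- c] == a)]|.
Proof. by move=> <-. Qed.

Lemma flag_sum (W : nmodType) k (E : seq nat -> W) :
  \sum_(a : k.+1.-tuple 'I_(adim P) | sorted ltn [seq val i | i <- a])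
     E [seq val i | i <- a] *+ flag_number P [seq val i | i <- a] =
  \sum_(c : k.+1.-tuple (faces P) | sorted lt c &&
       all (fun G => adim (val G) < adim P)%N c)
     E [seq adim (val G) | G <- c].
Proof.
have [P0|P_gt0] := posnP (adim P).
  rewrite !big_pred0 // => [c|a]; last by case: (thead a) => m; rewrite {1}P0.
  by case/tupleP: c => G c /=; rewrite {1}P0 /= andbF.
(* Only a default for [insubd]; it is never taken on the flags summed over, whose dimensions are
   below [adim P]. *)
pose i0 := Ordinal P_gt0.
pose h (c : k.+1.-tuple (faces P)) := map_tuple (fun G => insubd i0 (adim (val G))) c.
have hE (c : k.+1.-tuple (faces P)) : all (fun G => adim (val G) < adim P)%N c ->
    [seq val i | i <- h c] = [seq adim (val G) | G <- c].
  move=> /allP ac; rewrite -map_comp; apply/eq_in_map => G Gc /=.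
  by rewrite val_insubd ac.
rewrite [RHS](partition_big h (fun a => sorted ltn [seq val i | i <- a])); last first.
  move=> c /andP[sc ac]; rewrite hE //; case: (tval c) sc => //= G s.
  exact: (homo_path (f := fun F => adim (val F)) adim_lt).
apply: eq_bigr => a _; rewrite (@flag_numberE k.+1) ?size_map ?size_tuple //.
rewrite -sumr_const; apply: eq_big => c.
  rewrite inE -andbA; congr (_ && _); apply/eqP/andP => [ca|[ac /eqP <-]]; last first.
    by rewrite hE.
  have ac : all (fun G => adim (val G) < adim P)%N c.
    have := all_map (fun G : faces P => adim (val G)) (fun m => m < adim P)%N c.
    rewrite ca => /esym; rewrite /preim /= => ->.
    by apply/allP => _ /mapP[i _ ->]; exact: ltn_ord.
  split=> //; apply/eqP/val_inj/(inj_map val_inj); rewrite -ca; exact: hE.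
by rewrite inE => /andP[_ /eqP->].
Qed.

Lemma coef_l_alpha i : (l_alpha P)`_i =
  \sum_(F : faces P | adim (val F) == i) rota_class (@interval_le R d P F).
Proof.
rewrite /l_alpha coef_sum [RHS]big_mkcond; apply: eq_bigr => F _.
by rewrite coefZ coefXn eq_sym; case: eqP; rewrite ?mulr1 ?mulr0.
Qed.

Lemma chain_weight_rcons F s :
  chain_weight F (rcons s whole_face) =
  qmon (rev (pairmap subn (adim P) (rev [seq adim (val G) | G <- F :: s]))).
Proof.
rewrite map_cons rev_pairmap_subn; congr qmon.
by elim: s F => //= G s IHs F; rewrite IHs.
Qed.

Lemma coef_star_f_polynomial i : (qsym_star_poly (f_polynomial (adim P) P))`_i =
  (i == adim P)%:R + \sum_(k < adim P) \sum_(F : faces P | adim (val F) == i)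
    \sum_(s : k.-tuple (faces P) | path lt F s && lt (last F s) whole_face)
      chain_weight F (rcons s whole_face).
Proof.
rewrite /qsym_star_poly coef_map_id0 ?raddf0 // /f_polynomial coefD raddfD /=.
congr (_ + _).
  rewrite coefXn; case: eqP => _; last exact: raddf0.
  by rewrite -qmon_nil qsym_star_qmon.
rewrite big_add1 /= big_mkord coef_sum raddf_sum; apply: eq_bigr => k _.
(* Taking the coefficient of ['X^i] keeps the flags whose smallest face has dimension i. *)
pose E a := if head 0%N a == i then qmon (rev (pairmap subn (adim P) (rev a))) else 0.
transitivity (\sum_(a : k.+1.-tuple 'I_(adim P) | sorted ltn [seq val i | i <- a])
     E [seq val i | i <- a] *+ flag_number P [seq val i | i <- a]).
  rewrite coef_sum raddf_sum; apply: eq_bigr => a _.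
  rewrite coefZ coefXn /E eq_sym; case: eqP => _; last by rewrite mulr0 raddf0 mul0rn.
  by rewrite mulr1 raddfMn /= qsym_star_qmon.
rewrite flag_sum (@big_tuple_cons _ _ _ (fun c => sorted lt c && all _ c)
   (fun c => E [seq adim (val G) | G <- c])) [RHS]big_mkcond.
apply: eq_bigr => F _; rewrite /E /=; case: eqP => _; last by rewrite big1.
apply: eq_big => [s|s _]; last by rewrite chain_weight_rcons.
by case h: (path _ _ _) => //=; rewrite face_path_all.
Qed.

Lemma coef_ehrenborg_l_alpha i : (ehrenborg_poly (l_alpha P))`_i =
  (i == adim P)%:R + \sum_(k < adim P) \sum_(F : faces P | adim (val F) == i)
    \sum_(s : k.-tuple (faces P) | path lt F s && lt (last F s) whole_face)
      chain_weight F (rcons s whole_face).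
Proof.
rewrite /ehrenborg_poly coef_map_id0 ?raddf0 // coef_l_alpha raddf_sum /=.
under eq_bigr do rewrite ehrenborg_face_interval.
(* The chains of length 0 have F = P and give the isolated term; longer chains end with a step into
   P, which [path_sum_rcons] splits off. *)
rewrite exchange_big big_ord_recl; congr (_ + _).
  transitivity (\sum_(F | F == whole_face) (i == adim (val F))%:R : qsym).
    rewrite big_mkcond [RHS]big_mkcond; apply: eq_bigr => F _.
    rewrite (@big_tuple0 _ _ (fun s => path lt F s && (last F s == whole_face))
               (chain_weight F)) /= /chain_weight qmon_nil eq_sym.
    by case: eqP; case: eqP.
  by rewrite big_pred1_eq.
apply: eq_bigr => k _; apply: eq_bigr => F _.
exact: path_sum_rcons.
Qed.

End FaceLattice.

Theorem proposition39 (R : realType) (d n : nat) (P : set 'rV[R]_d)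
    (P_polytope : polytope P) (P_dim : adim P = n) :
  ehrenborg_poly (l_alpha P) = qsym_star_poly (f_polynomial n P).
Proof.
case: P_polytope => V V0 PE; rewrite -{}P_dim {P}PE; apply/polyP => i.
by rewrite coef_ehrenborg_l_alpha // coef_star_f_polynomial.
Qed.
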